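(* Let $C=(C_\bullet,d,s,t)$ be an $H$-unital para-precyclic $k$-module with $k\supset\mathbb Q$. Let $x\in C_\bullet$ be such that $bx\in\operatorname{ran}(1-\tau)$. Then, in $C_{T,\bullet}$, $$B\circ S(x^\lambda)=-b\bar x\qquad\bmod\ \operatorname{ran}\big[b(1-\tau)\big],$$ where $\operatorname{ran}[b(1-\tau)]$ is the range of $b(1-\tau)$ acting on $C_{T,\bullet}$.
   Context: $k$ is a unital ring, not assumed commutative; $k$-modules are left modules. A para-precyclic $k$-module consists of $k$-modules $C_m$, $m\ge0$, face maps $d_j:C_m\to C_{m-1}$ ($0\le j\le m$) with $d_id_j=d_{j-1}d_i$ for $i<j$, and an invertible $k$-linear map $t:C_\bullet\to C_\bullet$ of degree $0$ with $td_i=d_{i+1}t$ for $0\le i\le m-1$ and $d_m=d_0t$ on $C_m$ (notation: $d=d_m$ on $C_m$). Put $T=t^{m+1}$ on $C_m$; it commutes with $d$ and $t$. Let $b=\sum_{j=0}^m(-1)^jd_j$, $b'=\sum_{j=0}^{m-1}(-1)^jd_j$, $\tau=(-1)^mt$, $N=1+\tau+\cdots+\tau^m$ on $C_m$. It is $H$-unital, written $(C_\bullet,d,s,t)$, when equipped with a $k$-linear map $s:C_\bullet\to C_{\bullet+1}$ commuting with $T$ with $b's+sb'=1$. Put $s'=sb's$ and $B=(1-\tau)s'N:C_\bullet\to C_{\bullet+1}$. Let $C_{T,\bullet}=C_\bullet/\operatorname{ran}(1-T)$, with canonical projection $\pi_T$, $\bar x:=\pi_T(x)$; $b,\tau$ descend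 to $C_{T,\bullet}$. $C^\lambda_m=C_m/\operatorname{ran}(1-\tau)$, with canonical projection $\pi^\lambda$, $x^\lambda:=\pi^\lambda(x)$. Since $B$ maps $\operatorname{ran}(1-\tau)$ into $\operatorname{ran}(1-T)$, it induces $B:C^\lambda_\bullet\to C_{T,\bullet+1}$, $B(x^\lambda)=\overline{Bx}$. The operator $S$: let $C^{\natural\natural}_m=\bigoplus_{p+q=m}C_qu^p$ ($p,q\ge0$, $u$ a formal variable), $u^{-1}(xu^p)=xu^{p-1}$ for $p\ge1$, $u^{-1}(xu^0)=0$, $\pi_0^{\natural\natural}(xu^0)=x$, $\pi_0^{\natural\natural}(xu^p)=0$ for $p\ge1$, $\delta(xu^{2p})=bxu^{2p}$, $\delta(xu^{2p+1})=-b'xu^{2p+1}$. For $x\in C_m$ put $\hat x=(m+1)^{-1}x$, $\hat Nx=N\hat x$, $\hat Dx=\sum_{j=0}^m(m-j)\tau^j\hat x$. Define $\nu(x)=\hat Nx\,u^0$; $\varphi(xu^{2p})=-\hat Dx\,u^{2p+1}$, $\varphi(xu^{2p+1})=-\hat x\,u^{2p+2}$; $\nu_0^{\natural\natural}=\sum_{j\ge0}(\varphi\delta)^j\nu:C_\bullet\to C^{\natural\natural}_\bullet$. Put $S_0x=\pi_0^{\natural\natural}(u^{-2}\nu_0^{\natural\natural}(x))$. It maps $\operatorname{ran}(1-\tau)$ into itself, and $S:C^\lambda_\bullet\to C^\lambda_{\bullet-2}$ is the induced map, $S\pi^\lambda=\pi^\lambda S_0$. *)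

(* Defs.v *)
From HB Require Import structures.
From mathcomp Require Import all_boot all_order all_algebra.
From mathcomp Require Import generic_quotient ring_quotient.
From mathcomp Require Import boolp.

Set Implicit Arguments.
Unset Strict Implicit.
Unset Printing Implicit Defensive.

Import GRing.Theory.
Local Open Scope ring_scope.
Local Open Scope quotient_scope.

(* The quotient V / ran f of k-modules. The library only equips quotients with
   a Zmodule structure; the scalar action is added here. *)
Section Cokernel.
Variables (k : nzRingType) (U V : lmodType k) (f : {linear U -> V}).

Definition ran : {pred V} := fun y => `[< exists x, y = f x >].

Lemma ran_submod_closed : submod_closed ran.
Proof.
split; first by apply/asboolP; exists 0; rewrite linear0.
move=> a u v /asboolP[x ->] /asboolP[y ->].
by apply/asboolP; exists (a *: x + y); rewrite linearP.
Qed.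

HB.instance Definition _ := GRing.isSubmodClosed.Build k V ran ran_submod_closed.

Definition coker : Type := Quotient.quot ran.
HB.instance Definition _ := GRing.Zmodule.on coker.
HB.instance Definition _ := Quotient.on coker.

Definition proj (x : V) : coker := \pi_coker x.

Lemma proj_is_zmod_morphism : zmod_morphism proj.
Proof. by move=> x y; rewrite /proj !piE. Qed.

Lemma proj_eqP (x y : V) : reflect (exists z, x - y = f z) (proj x == proj y).
Proof.
rewrite /proj -[\pi_coker x == _]/(x == y %[mod Quotient.quot ran]).
by rewrite -Quotient.idealrBE; apply: asboolP.
Qed.

Lemma proj_repr (q : coker) : proj (repr q) = q.
Proof. exact: reprK. Qed.

Definition coker_scale (a : k) (q : coker) : coker := proj (a *: repr q).

Lemma proj_scale a x : proj (a *: x) = coker_scale a (proj x).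
Proof.
apply/eqP/proj_eqP; have /eqP/proj_eqP[z e] := esym (proj_repr (proj x)).
by exists (a *: z); rewrite -scalerBr e linearZ.
Qed.

Lemma projB x y : proj (x - y) = proj x - proj y.
Proof. exact: proj_is_zmod_morphism. Qed.

Lemma proj0 : proj 0 = 0.
Proof. by rewrite -(subrr 0) projB subrr. Qed.

Lemma projD x y : proj (x + y) = proj x + proj y.
Proof. by rewrite -{1}[y]opprK projB -[- y]sub0r projB proj0 sub0r opprK. Qed.

Lemma coker_scaleA a b q : coker_scale a (coker_scale b q) = coker_scale (a * b) q.
Proof. by rewrite -[q]proj_repr -!proj_scale scalerA. Qed.

Lemma coker_scale1 : left_id 1 coker_scale.
Proof. by move=> q; rewrite -[q]proj_repr -proj_scale scale1r. Qed.

Lemma coker_scaleDr : right_distributive coker_scale +%R.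
Proof.
move=> a p q; rewrite -[p]proj_repr -[q]proj_repr -projD -!proj_scale -projD.
by rewrite scalerDr.
Qed.

Lemma coker_scaleDl q : {morph coker_scale^~ q : a b / a + b}.
Proof. by move=> a b; rewrite -[q]proj_repr -!proj_scale -projD scalerDl. Qed.

HB.instance Definition _ := GRing.Zmodule_isLmodule.Build k coker
  coker_scaleA coker_scale1 coker_scaleDr coker_scaleDl.
HB.instance Definition _ := GRing.isZmodMorphism.Build V coker proj
  proj_is_zmod_morphism.
HB.instance Definition _ := GRing.isScalable.Build k V coker *:%R proj
  proj_scale.

End Cokernel.

(* The map V / ran f -> V' / ran f' induced by g : V -> V'. It is defined on
   the representatives chosen by [repr], and is the induced map as soon as g
   maps ran f into ran f' (lemma descendE). *)
Definition descend (k : nzRingType) (U V U' V' : lmodType k)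
  (f : {linear U -> V}) (f' : {linear U' -> V'}) (g : V -> V') :
  coker f -> coker f' := fun q => proj f' (g (repr q)).
Arguments descend {k U V U' V'} f f' g q.

Lemma descendE (k : nzRingType) (U V U' V' : lmodType k)
  (f : {linear U -> V}) (f' : {linear U' -> V'}) (g : V -> V') :
  {morph g : x y / x - y} -> (forall x, exists y, g (f x) = f' y) ->
  forall x, descend f f' g (proj f x) = proj f' (g x).
Proof.
move=> gB gf x; apply/eqP/proj_eqP.
have /eqP/proj_eqP[z e] := proj_repr (proj f x).
by rewrite -gB e; apply: gf.
Qed.

(* Graded modules M : nat -> lmodType k are extended by 0 in negative degrees:
   [below M m] is M_{m-1}, with M_{-1} = 0. *)
Section Grading.
Variable k : nzRingType.
Implicit Types M N : nat -> lmodType k.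

Definition below M (m : nat) : lmodType k :=
  if m is p.+1 then M p else 'rV[k]_0.

Definition below_map M N (f : forall m, M m -> N m) (m : nat) :
    below M m -> below N m :=
  match m with 0 => fun=> 0 | p.+1 => f p end.

(* A degree -1 map; its component in degree 0 is M_0 -> N_{-1} = 0. *)
Definition lower M N (f : forall m, M m.+1 -> N m) (m : nat) :
    M m -> below N m :=
  match m with 0 => fun=> 0 | p.+1 => f p end.

(* A degree 1 map; its component in degree -1 is 0 = M_{-1} -> N_0. *)
Definition raise M N (f : forall m, M m -> N m.+1) (m : nat) :
    below M m -> N m :=
  match m with 0 => fun=> 0 | p.+1 => f p end.

End Grading.
Arguments below_map {k M N} f m.
Arguments lower {k M N} f m.
Arguments raise {k M N} f m.

(* [face m j] is d_j : C_{m+1} -> C_m; the face map d_0 : C_0 -> C_{-1} = 0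
   carries no data. *)
Record para_precyclic (k : nzRingType) := ParaPrecyclic {
  pcyc_mod :> nat -> lmodType k;
  face : forall m, 'I_m.+2 -> {linear pcyc_mod m.+1 -> pcyc_mod m};
  cyc : forall m, {linear pcyc_mod m -> pcyc_mod m};
  face_face : forall m i j (x : pcyc_mod m.+2), (i < j <= m.+2)%N ->
    face (inord i) (face (inord j) x) = face (inord j.-1) (face (inord i) x);
  cyc_bij : forall m, bijective (cyc m);
  cyc_face : forall m i (x : pcyc_mod m.+1), (i <= m)%N ->
    cyc m (face (inord i) x) = face (inord i.+1) (cyc m.+1 x);
  face_last : forall m (x : pcyc_mod m.+1),
    face ord_max x = face ord0 (cyc m.+1 x)
}.
Arguments face {k C m} j : rename.
Arguments cyc {k C m} : rename.

Section Operators.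
Variables (k : nzRingType) (C : para_precyclic k).

(* b, b' : C_{m+1} -> C_m; both vanish on C_0. *)
Definition b m (x : C m.+1) : C m := \sum_(j < m.+2) (-1) ^+ j *: face j x.

Definition b' m (x : C m.+1) : C m :=
  \sum_(j < m.+1) (-1) ^+ j *: face (widen_ord (leqnSn m.+1) j) x.

Definition tau m (x : C m) : C m := (-1) ^+ m *: cyc x.

Definition T m : C m -> C m := iter m.+1 cyc.

Definition N m (x : C m) : C m := \sum_(j < m.+1) iter j (@tau m) x.

Lemma scale_sign n (V : lmodType k) (a : k) (x : V) :
  (-1) ^+ n *: (a *: x) = a *: ((-1) ^+ n *: x).
Proof. by rewrite !scalerA commr_sign. Qed.

Lemma b_is_linear m : linear (@b m).
Proof.
move=> a x y; rewrite /b scaler_sumr -big_split; apply: eq_bigr => j _ /=.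
by rewrite linearP scalerDr scale_sign.
Qed.
HB.instance Definition _ m := GRing.isLinear.Build k _ _ _ (@b m) (@b_is_linear m).

Lemma b'_is_linear m : linear (@b' m).
Proof.
move=> a x y; rewrite /b' scaler_sumr -big_split; apply: eq_bigr => j _ /=.
by rewrite linearP scalerDr scale_sign.
Qed.
HB.instance Definition _ m := GRing.isLinear.Build k _ _ _ (@b' m) (@b'_is_linear m).

Lemma tau_is_linear m : linear (@tau m).
Proof. by move=> a x y; rewrite /tau linearP scalerDr scale_sign. Qed.
HB.instance Definition _ m := GRing.isLinear.Build k _ _ _ (@tau m) (@tau_is_linear m).

Lemma T_is_linear m : linear (@T m).
Proof.
rewrite /T => a x y; elim: m.+1 => //= n ->.
by rewrite linearP.
Qed.
HB.instance Definition _ m := GRing.isLinear.Build k _ _ _ (@T m) (@T_is_linear m).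

Lemma iter_tau_is_linear m n : linear (iter n (@tau m)).
Proof. by move=> a x y; elim: n => //= n ->; rewrite linearP. Qed.

Lemma N_is_linear m : linear (@N m).
Proof.
move=> a x y; rewrite /N scaler_sumr -big_split; apply: eq_bigr => j _ /=.
exact: iter_tau_is_linear.
Qed.
HB.instance Definition _ m := GRing.isLinear.Build k _ _ _ (@N m) (@N_is_linear m).

Definition one_tau m : {linear C m -> C m} := idfun \- @tau m.
Definition one_T m : {linear C m -> C m} := idfun \- @T m.

Definition CT m : lmodType k := coker (one_T m).
Definition Clam m : lmodType k := coker (one_tau m).

Definition piT m : C m -> CT m := proj (one_T m).
Definition pilam m : C m -> Clam m := proj (one_tau m).

Definition bT m : CT m.+1 -> CT m := descend (one_T m.+1) (one_T m) (@b m).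
Definition tauT m : CT m -> CT m := descend (one_T m) (one_T m) (@tau m).

Lemma iter_cyc_face m n i (x : C m.+1) : (i + n <= m.+1)%N ->
  iter n cyc (face (inord i) x) = face (inord (i + n)) (iter n cyc x).
Proof.
elim: n => [|n IHn] lin; first by rewrite addn0.
rewrite addnS in lin.
by rewrite /= IHn 1?ltnW // cyc_face // addnS.
Qed.

Lemma T_face m (j : 'I_m.+2) (x : C m.+1) : T (face j x) = face j (T x).
Proof.
have lej : (j <= m.+1)%N by rewrite -ltnS.
have eL : m.+1 = (j + (m.+1 - j))%N by rewrite subnKC.
have eR : m.+2 = (j + (m.+1 - j).+1)%N by rewrite addnS -eL.
have it n p q (A : Type) (f : A -> A) y :
  n = (p + q)%N -> iter n f y = iter p f (iter q f y) by move->; rewrite iterD.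
rewrite /T (it _ _ _ _ _ _ eL) (it _ _ _ _ _ _ eR) -{3}[j]inord_val.
rewrite iter_cyc_face subnKC //.
have -> : inord m.+1 = ord_max :> 'I_m.+2 by apply/val_inj; rewrite /= inordK.
rewrite face_last -iterS.
have -> : ord0 = inord 0 :> 'I_m.+2 by apply/val_inj; rewrite /= inordK.
by rewrite iter_cyc_face // add0n inord_val.
Qed.

Lemma T_b m (x : C m.+1) : T (b x) = b (T x).
Proof.
by rewrite /b linear_sum; apply: eq_bigr => j _; rewrite linearZ /= T_face.
Qed.

Lemma T_b' m (x : C m.+1) : T (b' x) = b' (T x).
Proof.
by rewrite /b' linear_sum; apply: eq_bigr => j _; rewrite linearZ /= T_face.
Qed.

Lemma T_tau m (x : C m) : T (tau x) = tau (T x).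
Proof. by rewrite /tau linearZ /= /T -iterS -iterSr. Qed.

Lemma iter_tau m n (x : C m) : iter n (@tau m) x = (-1) ^+ (n * m) *: iter n cyc x.
Proof.
elim: n => [|n IHn]; first by rewrite expr0 scale1r.
by rewrite iterS IHn /tau linearZ scalerA -exprD.
Qed.

Lemma N_one_tau m (x : C m) : N (one_tau m x) = one_T m x.
Proof.
rewrite /one_tau /one_T /= linearB /=.
transitivity (x - iter m.+1 (@tau m) x); last first.
  by rewrite iter_tau -signr_odd oddM /= andNb expr0 scale1r.
rewrite /N -sumrB; have := telescope_sumr (fun j => iter j (@tau m) x) (leq0n m.+1).
rewrite big_mkord => /(congr1 -%R); rewrite opprB -sumrN => <-.
by apply: eq_bigr => j _; rewrite opprB -iterSr.
Qed.

Lemma one_tau_N m (x : C m) : one_tau m (N x) = one_T m x.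
Proof.
rewrite -N_one_tau /one_tau /= linearB /=; congr (_ - _).
by rewrite /N linear_sum; apply: eq_bigr => j _; rewrite /= -iterS -iterSr.
Qed.

Lemma T_N m (x : C m) : T (N x) = N (T x).
Proof.
rewrite /N linear_sum; apply: eq_bigr => j _ /=.
by elim: (nat_of_ord j) => //= n <-; rewrite T_tau.
Qed.

Lemma bT_E m (x : C m.+1) : bT (piT x) = piT (b x).
Proof.
apply: descendE => [y z|y]; first exact: linearB.
by exists (b y); rewrite /one_T /= linearB /= T_b.
Qed.

Lemma tauT_E m (x : C m) : tauT (piT x) = piT (tau x).
Proof.
apply: descendE => [y z|y]; first exact: linearB.
by exists (tau y); rewrite /one_T /= linearB /= T_tau.
Qed.

End Operators.

Record Hunital (k : nzRingType) := HUnital {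
  hu_pcyc :> para_precyclic k;
  htpy : forall m, {linear hu_pcyc m -> hu_pcyc m.+1};
  htpy_T : forall m (x : hu_pcyc m), htpy m (T x) = T (htpy m x);
  htpy_b' : forall m (x : hu_pcyc m),
    b' (htpy m x) + raise htpy m (lower (@b' k hu_pcyc) m x) = x
}.
Arguments htpy {k C m} : rename.

Section OperatorB.
Variables (k : nzRingType) (C : Hunital k).

Definition s' m (x : C m) : C m.+1 := htpy (b' (htpy x)).

Definition B m (x : C m) : C m.+1 := one_tau C m.+1 (s' (N x)).

Definition Blam m : Clam C m -> CT C m.+1 :=
  descend (one_tau C m) (one_T C m.+1) (@B m).

Lemma s'_T m (x : C m) : s' (T x) = T (s' x).
Proof. by rewrite /s' htpy_T -T_b' htpy_T. Qed.

Lemma Blam_E m (x : C m) : Blam (pilam x) = piT (B x).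
Proof.
apply: descendE => [y z|y]; first by rewrite /B /s' !linearB.
exists (one_tau C m.+1 (s' y)).
have s'B u v : s' (u - v) = s' u - s' v by rewrite /s' !linearB.
rewrite /B N_one_tau /one_T /= s'B s'_T !linearB /= !T_tau.
exact: addrACA.
Qed.

End OperatorB.

(* The inclusion of the rationals in k is given by iota; a ring morphism from
   rat to a nontrivial ring is unique, injective, and has central image. *)
Section OperatorS.
Variables (k : nzRingType) (iota : {rmorphism rat -> k}) (C : para_precyclic k).

Definition hat m (x : C m) : C m := iota (m.+1%:R^-1) *: x.
Definition Nhat m (x : C m) : C m := N (hat x).
Definition Dhat m (x : C m) : C m :=
  \sum_(j < m.+1) (iter j (@tau k C m) (hat x) *+ (m - j)).

(* [Cnn n] is the double-natural module in degree n-1: the direct sum of the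
   C_q u^p with p + q = n - 1. An element of Cnn n.+1 = C_n * Cnn n is a pair (x, y)
   standing for x u^0 + y u, so u^{-1} is the second projection. *)
Fixpoint Cnn (n : nat) : lmodType k :=
  if n is p.+1 then (C p * Cnn p)%type else 'rV[k]_0.

Definition pi0 n (z : Cnn n.+1) : C n := z.1.
Definition uinv n (z : Cnn n.+1) : Cnn n := z.2.

(* The coefficient of u^p is treated according to the parity of p: the flag is
   the parity of the exponent carried by the first component. *)
Fixpoint delta_par (odd_exp : bool) (n : nat) : Cnn n.+1 -> Cnn n :=
  match n with
  | 0 => fun=> 0
  | p.+1 => fun z =>
      (if odd_exp then - b' (pi0 z) else b (pi0 z),
       delta_par (~~ odd_exp) (uinv z))
  end.
Definition delta n : Cnn n.+1 -> Cnn n := @delta_par false n.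

Fixpoint phi_par (odd_exp : bool) (n : nat) : Cnn n -> Cnn n :=
  match n with
  | 0 => fun=> 0
  | p.+1 => fun z =>
      (if odd_exp then - hat (pi0 z) else - Dhat (pi0 z),
       phi_par (~~ odd_exp) (uinv z))
  end.
Definition phi n (z : Cnn n) : Cnn n.+1 := (0, phi_par false z).

Definition nu m (x : C m) : Cnn m.+1 := (Nhat x, 0).

(* (phi delta)^j raises the exponent of u by j, hence vanishes on nu x for
   j > m. *)
Definition nu0 m (x : C m) : Cnn m.+1 :=
  \sum_(j < m.+1) iter j (fun z : Cnn m.+1 => phi (delta z)) (nu x).

Definition S0 m (x : C m.+2) : C m := pi0 (uinv (uinv (nu0 x))).

Definition Slam m : Clam C m.+2 -> Clam C m :=
  descend (one_tau C m.+2) (one_tau C m) (@S0 m).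

Lemma hatB m : {morph @hat m : x y / x - y}.
Proof. by move=> x y; rewrite /hat scalerBr. Qed.

Lemma NhatB m : {morph @Nhat m : x y / x - y}.
Proof. by move=> x y; rewrite /Nhat hatB linearB. Qed.

Lemma DhatB m : {morph @Dhat m : x y / x - y}.
Proof.
move=> x y; rewrite /Dhat -sumrB; apply: eq_bigr => j _; rewrite -mulrnBl hatB.
congr (_ *+ _); elim: (nat_of_ord j) => //= n ->; exact: linearB.
Qed.

Lemma T_hat m (x : C m) : T (hat x) = hat (T x).
Proof. by rewrite /hat linearZ. Qed.

Lemma T_Dhat m (x : C m) : T (Dhat x) = Dhat (T x).
Proof.
rewrite /Dhat linear_sum; apply: eq_bigr => j _ /=; rewrite linearMn -T_hat.
by congr (_ *+ _); elim: (nat_of_ord j) => //= n <-; rewrite T_tau.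
Qed.

Lemma S0E m (x : C m.+2) : S0 x = - hat (b' (Dhat (b (Nhat x)))).
Proof.
rewrite /S0 /nu0; pose F z := phi (@delta m.+2 z).

have hat0 n : @hat n 0 = 0 by rewrite /hat scaler0.
have Dhat0 n : @Dhat n 0 = 0 by have := DhatB (0 : C n) 0; rewrite !subrr.
have F0 z : pi0 (F z) = 0 by [].
have F1 z : pi0 (uinv (F z)) = - Dhat (b (pi0 z)) by [].
have F2 z : pi0 (uinv (uinv (F z))) = - hat (- b' (pi0 (uinv z))) by [].
have sumE (I : Type) (r : seq I) (G : I -> Cnn m.+3) :
    pi0 (uinv (uinv (\sum_(j <- r) G j))) = \sum_(j <- r) pi0 (uinv (uinv (G j))).
  by elim/big_rec2: _ => [|j u v _ <-].
rewrite sumE -(big_mkord xpredT (fun j => pi0 (uinv (uinv (iter j F (nu x)))))).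
rewrite !big_nat_recl // big1 => [|j _]; last first.
  by rewrite [iter _ _ _]iterS F2 iterS F1 iterS F0 linear0 Dhat0 oppr0 linear0 oppr0 hat0 oppr0.
rewrite [iter 1 _ _]iterS [iter 2 _ _]iterS iterS !F2 F1 addr0 /= linear0 oppr0 hat0 oppr0.
by rewrite !add0r linearN opprK.
Qed.

Lemma Slam_E m (x : C m.+2) : Slam (@pilam k C _ x) = @pilam k C _ (S0 x).
Proof.
apply: descendE => [y z|y].
  by rewrite !S0E NhatB linearB DhatB linearB hatB opprD.
exists (N (- hat (b' (Dhat (b (hat y)))))).
have e : Nhat (@one_tau k C m.+2 y) = one_T C m.+2 (hat y).
  by rewrite -N_one_tau /Nhat /hat; congr N; rewrite linearZ.
rewrite one_tau_N S0E e /one_T /= linearB /= -T_b DhatB -T_Dhat linearB /= -T_b' hatB -T_hat.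
by rewrite linearN /= opprB opprK addrC.
Qed.

(* S in all degrees; it vanishes on degrees 0 and 1. *)
Definition Sop m : Clam C m -> below (below (Clam C)) m :=
  lower (lower (M := fun n => Clam C n.+1) Slam) m.

End OperatorS.

(* The composite B o S of degree -1. *)
Definition BS (k : nzRingType) (iota : {rmorphism rat -> k}) (C : Hunital k) m :
    Clam C m -> below (CT C) m :=
  fun q => below_map (raise (@Blam k C)) m (Sop iota q).

(* Main.v *)
From HB Require Import structures.
Require Import Defs.
From mathcomp Require Import all_boot all_order all_algebra.
Set Implicit Arguments.
Unset Strict Implicit.
Unset Printing Implicit Defensive.

Import GRing.Theory.
Local Open Scope ring_scope.

(** Write D for [Dhat] and N^ for [Nhat]. Working modulo ran (1 - T),
    the argument is as follows. The two averaging identities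
      D (1 - tau) = (1 - tau) D = 1 - N^          (sum_weighted_sub)
    and the two commutation rules
      b (1 - tau) = (1 - tau) b',     N b = b' N   (b_one_tau, N_b)
    hold on the nose, as do b b = b' b' = 0. The map [S0] sends x to -w^,
    where w^ is [hat w], w = b' v and v = D b N^ x; thus B S x is
    - (1 - tau) s' N^ w.

    The hypothesis b x = (1 - tau) y gives b' N x = N b x = (1 - T) y, which is
    0 modulo ran (1 - T); hence so is N^ b N^ x (Nhat_b_Nhat). Consequently
    (1 - tau) v = b N^ x - N^ b N^ x agrees with b N^ x, and
    (1 - tau) w = b (1 - tau) v = - b N^ b N^ x vanishes, so that N^ w = w.
    Finally b' s + s b' = 1 and b' b' = 0 give s' b' v = v - b' s v, whence
      B S x = - (1 - tau) s' b' v = - (1 - tau) v + (1 - tau) b' s v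
            = - b N^ x + b (1 - tau) s v
            = - b x + b (1 - tau) (D x + s v),
    the last step because N^ = 1 - (1 - tau) D. The class z is thus that of
    D x + s v.

    These congruences are carried out in C itself, with explicit correction
    terms in ran (1 - T), and projected to C_T only at the end. *)

(** * Two identities for finite sums *)

(** Both b b = 0 and b' b' = 0 are instances, with n the number of summands
    of the outer operator: the pairs i < j cancel against the pairs j <= i through
    (i, j) |-> (j - 1, i). *)
Lemma sum_simplicial (V : zmodType) (G : nat -> nat -> V) n :
  (forall i j, (i < j <= n)%N -> G i j = - G j.-1 i) ->
  \sum_(0 <= i < n) \sum_(0 <= j < n.+1) G i j = 0.
Proof.
elim: n => [|n IHn] Gij; first by rewrite big_nil.
rewrite big_nat_recr //=.
under eq_bigr do rewrite big_nat_recr //=.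
rewrite big_split /= IHn => [|i j /andP[lij ljn]]; last first.
  by rewrite Gij // lij ltnW.
(* What is left is the last row and the last column, which cancel termwise. *)
rewrite add0r (big_nat_recr n.+1) //= addrCA.
rewrite -(big_nat_recr n 0%N (fun i => G i n.+1)) //= -big_split big_nat.
rewrite big1 //= => i lin.
by rewrite [G i _]Gij ?lin //= subrr.
Qed.

(** With a_j = tau^j h this computes (1 - tau) applied to the weighted average
    sum_j (m - j) tau^j h. *)
Lemma sum_weighted_sub (V : zmodType) (a : nat -> V) m :
  \sum_(j < m.+1) a j *+ (m - j) - \sum_(j < m.+1) a j.+1 *+ (m - j) =
  a 0 *+ m.+1 - \sum_(j < m.+1) a j.
Proof.
apply/eqP; rewrite subr_eq addrAC eq_sym subr_eq eq_sym -big_split /=; apply/eqP.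
under eq_bigr => j _ do rewrite -mulrSr -subSn -1?ltnS //.
rewrite big_ord_recl subn0 [in RHS]big_ord_recr /= subnn mulr0n addr0.
by congr (_ + _); apply: eq_bigr.
Qed.

(** * Faces, rotation and averages *)

Section Para.
Variables (k : nzRingType) (C : para_precyclic k).

(** Carrying the sign makes the rotation relations sign-free:
    tau e_j = e_{j+1} tau, and e_{m+1} = e_0 tau for the last face. *)
Definition sgn_face m (i : nat) (x : C m.+1) : C m :=
  (-1) ^+ i *: face (inord i) x.

Local Notation tauC := (@tau k C _).

Lemma bE m (x : C m.+1) : b x = \sum_(0 <= i < m.+2) sgn_face i x.
Proof.
by rewrite /b big_mkord; apply: eq_bigr => j _; rewrite /sgn_face inord_val.
Qed.

Lemma b'E m (x : C m.+1) : b' x = \sum_(0 <= i < m.+1) sgn_face i x.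
Proof.
rewrite /b' big_mkord; apply: eq_bigr => j _; rewrite /sgn_face.
by congr (_ *: face _ _); apply/val_inj; rewrite /= inordK // ltnW // ltnS.
Qed.

Lemma sgn_face_is_linear m i : linear (@sgn_face m i).
Proof. by move=> a x y; rewrite /sgn_face linearP scalerDr scale_sign. Qed.
HB.instance Definition _ m i :=
  GRing.isLinear.Build k _ _ _ (@sgn_face m i) (@sgn_face_is_linear m i).

Lemma sgn_face_sgn_face m i j (x : C m.+2) : (i < j <= m.+2)%N ->
  sgn_face i (sgn_face j x) = - sgn_face j.-1 (sgn_face i x).
Proof.
move=> lij; rewrite /sgn_face !linearZ /= face_face // !scalerA.
rewrite -!exprD scalerN -scaleNr.
congr (_ *: _); case: j lij => // j _.
by rewrite addnS exprS mulN1r addnC.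
Qed.

Lemma sum_sgn_face_sgn_face m n (x : C m.+2) : (n <= m.+2)%N ->
  \sum_(0 <= i < n) sgn_face i (\sum_(0 <= j < n.+1) sgn_face j x) = 0.
Proof.
move=> lnm; under eq_bigr do rewrite linear_sum.
apply: (@sum_simplicial _ (fun i j => sgn_face i (sgn_face j x))) => i j.
by case/andP=> lij ljn; rewrite sgn_face_sgn_face // lij (leq_trans ljn).
Qed.

Lemma b_b m (x : C m.+2) : b (b x) = 0.
Proof. by rewrite !bE sum_sgn_face_sgn_face. Qed.

Lemma b'_b' m (x : C m.+2) : b' (b' x) = 0.
Proof. by rewrite !b'E sum_sgn_face_sgn_face. Qed.

Lemma tau_sgn_face m i (x : C m.+1) : (i <= m)%N ->
  tau (sgn_face i x) = sgn_face i.+1 (tau x).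
Proof.
move=> lim; rewrite /tau /sgn_face !linearZ /= cyc_face // !scalerA.
by congr (_ *: _); rewrite !exprS !mulN1r mulrNN commr_sign.
Qed.

Lemma sgn_face_last m (x : C m.+1) : sgn_face m.+1 x = sgn_face 0 (tau x).
Proof.
rewrite /sgn_face /tau expr0 scale1r linearZ /=; congr (_ *: _).
have -> : inord m.+1 = ord_max :> 'I_m.+2 by apply/val_inj; rewrite /= inordK.
have -> : inord 0 = ord0 :> 'I_m.+2 by apply/val_inj; rewrite /= inordK.
exact: face_last.
Qed.

(** Pushing tau^i through b shifts the faces e_j to e_{i+j}; the faces with
    i + j > m wrap around through e_{m+1} = e_0 tau and pick up one more tau. *)
Lemma iter_tau_b m i (x : C m.+1) : (i <= m.+1)%N ->
  iter i tauC (b x) =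
    \sum_(i <= a < m.+1) sgn_face a (iter i tauC x) +
    \sum_(0 <= a < i.+1) sgn_face a (iter i.+1 tauC x).
Proof.
elim: i => [|i IHi] lim.
  by rewrite /= bE big_nat_recr //= big_nat1 sgn_face_last.
rewrite iterS IHi 1?ltnW // linearD !linear_sum /=.
have shift p q (y : C m.+1) : (q <= m.+1)%N ->
    \sum_(p <= a < q) tau (sgn_face a y) =
    \sum_(p.+1 <= a < q.+1) sgn_face a (tau y).
  move=> lqm; rewrite big_add1; apply: eq_big_nat => a /andP[_ laq].
  by rewrite tau_sgn_face // -ltnS (leq_trans laq).
rewrite !shift // big_nat_recr //= sgn_face_last -addrA; congr (_ + _).
by rewrite [RHS]big_nat_recl // big_add1.
Qed.

(** In [iter_tau_b] the face e_a occurs after tau^i for i <= a, and after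
    tau^{i+1} for a <= i, so that summing over i <= m yields e_a N. *)
Lemma N_b m (x : C m.+1) : N (b x) = b' (N x).
Proof.
rewrite /N linear_sum -!(big_mkord xpredT (fun j => iter j _ _)) /=.
rewrite -(big_mkord xpredT (fun j => b' (iter j tauC x))) /=.
under eq_big_nat => i /andP[_ lim] do rewrite iter_tau_b 1?ltnW //.
under [RHS]eq_bigr do rewrite b'E.
rewrite big_split /= [RHS]exchange_big_nat /=.
under eq_bigr do rewrite (big_nat_widenl _ 0) //.
rewrite (exchange_big_dep_nat xpredT) //=.
under [X in _ + X]eq_big_nat => i /andP[_ lim] do
  rewrite (big_nat_widen _ _ m.+1) //.
rewrite [X in _ + X](exchange_big_dep_nat xpredT) //= -big_split /=.
apply: eq_big_nat => a /andP[_ lam].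
rewrite [RHS](big_cat_nat (n := a.+1)) ?ltnS 1?ltnW //=; congr (_ + _).
  by rewrite [RHS](big_nat_widen 0 a.+1 m.+1).
by rewrite big_add1 /= [RHS](big_nat_widenl a 0).
Qed.

(** As tau e_j = e_{j+1} tau, all of b tau except e_0 tau is tau b'; and e_0 tau
    is the last face, the difference between b and b'. *)
Lemma b_one_tau m (x : C m.+1) : b (one_tau C m.+1 x) = one_tau C m (b' x).
Proof.
have tau_b' : tau (b' x) = \sum_(0 <= i < m.+1) sgn_face i.+1 (tau x).
  rewrite b'E linear_sum; apply: eq_big_nat => i /andP[_ lim].
  by rewrite /= tau_sgn_face.
rewrite /one_tau /= linearB /= tau_b' !bE b'E.
rewrite big_nat_recr //= sgn_face_last [X in _ - X = _]big_nat_recl //=.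
by rewrite opprD addrA addrK.
Qed.

Lemma b_one_T m (x : C m.+1) : b (one_T C m.+1 x) = one_T C m (b x).
Proof. by rewrite /one_T /= linearB /= T_b. Qed.

Lemma b'_one_T m (x : C m.+1) : b' (one_T C m.+1 x) = one_T C m (b' x).
Proof. by rewrite /one_T /= linearB /= T_b'. Qed.

Lemma one_tau_one_T m (x : C m) :
  one_tau C m (one_T C m x) = one_T C m (one_tau C m x).
Proof. by rewrite -N_one_tau one_tau_N. Qed.

Section Averages.
Variable iota : {rmorphism rat -> k}.
Local Notation hat := (hat iota).
Local Notation Nhat := (Nhat iota).
Local Notation Dhat := (Dhat iota).

Lemma hatMn m (x : C m) : hat x *+ m.+1 = x.
Proof.
rewrite /Defs.hat -scaler_nat scalerA -(rmorph_nat iota) -rmorphM /=.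
by rewrite mulfV ?Num.Theory.pnatr_eq0 // (rmorph1 iota) scale1r.
Qed.

Lemma one_tau_Dhat m (x : C m) : one_tau C m (Dhat x) = x - Nhat x.
Proof.
rewrite -{1}[x in RHS]hatMn /Defs.Nhat /N.
have /= <- := sum_weighted_sub (fun j => iter j tauC (hat x)) m.
rewrite /one_tau /=; congr (_ - _); rewrite linear_sum.
by apply: eq_bigr => j _; rewrite linearMn.
Qed.

Lemma Dhat_one_tau m (x : C m) : Dhat (one_tau C m x) = x - Nhat x.
Proof.
rewrite -one_tau_Dhat /one_tau /= DhatB; congr (_ - _).
rewrite /Defs.Dhat linear_sum; apply: eq_bigr => j _ /=; rewrite linearMn /=.
by rewrite -iterS iterSr /Defs.hat linearZ.
Qed.

Lemma N_hat m (x : C m) : N (hat x) = hat (N x).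
Proof. by rewrite /Defs.hat linearZ. Qed.

Lemma Dhat_one_T m (x : C m) : Dhat (one_T C m x) = one_T C m (Dhat x).
Proof. by rewrite /one_T /= DhatB T_Dhat. Qed.

Lemma DhatN m (x : C m) : Dhat (- x) = - Dhat x.
Proof.
have D0 : Dhat (0 : C m) = 0.
  by have := DhatB iota (0 : C m) 0; rewrite !subrr.
by rewrite -[- x]sub0r DhatB D0 sub0r.
Qed.

Lemma hat_one_T m (x : C m) : hat (one_T C m x) = one_T C m (hat x).
Proof. by rewrite /one_T /= hatB T_hat. Qed.

(** This is how the hypothesis on b x enters. As N b = b' N, the left side is a
    multiple of b' N N x; and N N^ x differs from N x by (1 - T) D x, while
    b' N x = N b x = N (1 - tau) y = (1 - T) y. *)
Lemma Nhat_b_Nhat m (x : C m.+1) (y : C m) : b x = one_tau C m y ->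
  Nhat (b (Nhat x)) = one_T C m (hat (y - b' (Dhat x))).
Proof.
move=> bx.
have NN : N (Nhat x) = N x - one_T C m.+1 (Dhat x).
  by rewrite -Dhat_one_T -one_tau_N Dhat_one_tau subKr /Defs.Nhat !N_hat.
rewrite /Defs.Nhat N_hat N_b NN linearB /= -N_b bx N_one_tau b'_one_T.
by rewrite -(linearB (one_T C m)) hat_one_T.
Qed.
End Averages.
End Para.

(** * The homotopy and the composite of B and S *)

Section Hunital.
Variables (k : nzRingType) (C : Hunital k) (iota : {rmorphism rat -> k}).

(** On ran b', which b' annihilates, the homotopy identity makes b' s the
    identity; so s' = s b' s agrees there with s, and s b' = 1 - b' s. *)
Lemma s'_b' m (v : C m.+1) : s' (b' v) = v - b' (htpy v).
Proof.
have sb' : htpy (b' v) = v - b' (htpy v).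
  apply/eqP; rewrite eq_sym subr_eq addrC eq_sym; apply/eqP; exact: htpy_b'.
have b'sb' : b' (htpy (b' v)) = b' v.
  by rewrite sb' linearB /= b'_b' subr0.
by rewrite /s' b'sb'.
Qed.

(** The witnesses are z = D x + s v and the accumulated correction term e, where
    v = D b N^ x; e collects the defects of (1 - tau) v = b N^ x and N^ w = w. *)
Lemma B_S0 m (x : C m.+2) (y : C m.+1) : b x = one_tau C m.+1 y ->
  exists z e, B (S0 iota x) =
    - b x + b (one_tau C m.+2 z) + one_T C m.+1 e.
Proof.
move=> bx; rewrite S0E.
set v := Dhat iota (b (Nhat iota x)).
set u := hat iota (y - b' (Dhat iota x)).
have one_tau_v : one_tau C m.+1 v = b (Nhat iota x) - one_T C m.+1 u.
  by rewrite one_tau_Dhat (Nhat_b_Nhat iota bx).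
have one_tau_w : one_tau C m (b' v) = - one_T C m (b u).
  by rewrite -b_one_tau one_tau_v linearB /= b_b sub0r b_one_T.
pose q := Dhat iota (b u).
have Nhat_w : Nhat iota (b' v) = b' v + one_T C m q.
  rewrite -[Nhat _ _](subKr (b' v)) -(Dhat_one_tau iota) one_tau_w.
  by rewrite DhatN Dhat_one_T opprK.
have s'w : one_tau C m.+1 (s' (b' v)) =
    b (Nhat iota x) - one_T C m.+1 u - b (one_tau C m.+2 (htpy v)).
  by rewrite s'_b' (linearB (one_tau C m.+1)) one_tau_v b_one_tau.
exists (Dhat iota x + htpy v), (u - one_tau C m.+1 (s' q)).
have bz : b (one_tau C m.+2 (Dhat iota x + htpy v)) =
    b x - b (Nhat iota x) + b (one_tau C m.+2 (htpy v)).
  by rewrite (linearD (one_tau C m.+2)) one_tau_Dhat linearD linearB.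
have s'N_w : s' (Nhat iota (b' v)) = s' (b' v) + one_T C m.+1 (s' q).
  by rewrite Nhat_w /s' !linearD /= -!/(s' _) -s'_T /s' !linearN.
have -> : B (- hat iota (b' v)) = - one_tau C m.+1 (s' (Nhat iota (b' v))).
  by rewrite /B /s' !linearN.
rewrite s'N_w (linearD (one_tau C m.+1)) one_tau_one_T s'w bz.
rewrite [one_T C m.+1 (u - _)]linearB.
have regroup (V : zmodType) (a c d u' w : V) :
    - (a - u' - c + w) = - d + (d - a + c) + (u' - w).
  by rewrite !addrA addNr add0r !opprD !opprK [- a + c + _]addrAC.
exact: regroup.
Qed.
End Hunital.

(** * Passage to the quotient by 1 - T *)

Section Quotient.
Variables (k : nzRingType) (C : para_precyclic k).

Lemma piT_one_T m (x : C m) : piT (one_T C m x) = 0.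
Proof.
rewrite /piT -(proj0 (one_T C m)); apply/eqP/proj_eqP.
by exists x; rewrite subr0.
Qed.

Lemma bT_one_tauT m (z : C m.+1) :
  bT (piT z - tauT (piT z)) = piT (b (one_tau C m.+1 z)).
Proof. by rewrite tauT_E -[piT z - _]projB -bT_E. Qed.

End Quotient.

Theorem proposition11p9 (k : nzRingType) (iota : {rmorphism rat -> k})
    (C : Hunital k) (m : nat) (x : C m)
    (hbx : exists y : below C m, lower (@b k C) m x = below_map (one_tau C) m y) :
  exists z : CT C m,
    BS iota (pilam x) =
      - lower (@bT k C) m (piT x) + lower (@bT k C) m (z - tauT z).
Proof.
case: m x hbx => [|[|m]] x [y bx].
- by exists 0; rewrite /= oppr0 addr0.
- (* Here S vanishes, and so does the class of b x in C_T, because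
     1 - tau = 1 - T on C_0. *)
  exists (piT 0); have yN : N y = y by rewrite /N big_ord1.
  have tau0 : one_tau C 0 y = one_T C 0 y by rewrite -one_tau_N yN.
  have bxT : b x = one_T C 0 y by rewrite -tau0; exact: bx.
  have bTx : bT (piT x) = 0 by rewrite bT_E bxT piT_one_T.
  rewrite /= bTx bT_one_tauT [one_tau C 1 0]linear0 [b 0]linear0 [piT 0]proj0.
  by rewrite oppr0 addr0.
have [z [e Be]] := B_S0 iota bx.
exists (piT z).
rewrite /BS /Sop /= Slam_E Blam_E Be bT_one_tauT bT_E.
have -> : - piT (b x) = piT (- b x) by rewrite [RHS]linearN.
by rewrite [LHS]projD [X in X + _]projD [proj _ (one_T _ _ e)]piT_one_T addr0.
Qed.
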